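(* (Progress.) In the language WasmFX defined in the context, let $s$ be a store, $F$ a frame, $e^*$ a sequence of (administrative) instructions, and $t^*$ a sequence of value types. If $\vdash s;F;e^* : t^*$, then either $e^* = r$ for some result $r$, or there exist $s',F',{e'}^*$ such that $s;F;e^* \hookrightarrow s';F';{e'}^*$. Here results are given by $$r ::= v^* \mid \mathsf{trap} \mid E[(\mathsf{throw}\,x)] \mid E^x[(\mathsf{suspend}\,x)],$$ i.e. a sequence of values, a trap, an unhandled exception, or an unhandled suspension.
   Context: WasmFX is a minimal WebAssembly core calculus with continuations. Superscript $*$ denotes finite sequences, superscript $n$ sequences of length $n$, $\epsilon$ the empty sequence. Indices $x$ (functions, tags, locals) and $l$ (labels) are natural numbers; labels are de Bruijn indices ($0$ = innermost). There is a single global module, so function and tag indices refer directly to the store. **Syntax.** Value types $t ::= \mathsf{i32} \mid \mathsf{i64} \mid \mathsf{ref}\,ft \mid \mathsf{ref\,cont}\,ft$; function types $ft ::= t^*\to t^*$. Handler clauses $h ::= \mathsf{on}\,x\,l$. Instructions $e ::= t.\mathsf{const}\,c$ ($t\in\{\mathsf{i32},\mathsf{i64}\}$) $\mid \mathsf{local.get}\,x \mid \mathsf{local.set}\,x \mid \mathsf{block}_{ft}\,e^* \mid \mathsf{loop}_{ft}\,e^* \mid \mathsf{br}\,l \mid \mathsf{br\_if}\,l \mid \mathsf{call\_ref}_{ft} \mid \mathsf{ref.null}_t$ ($t$ a reference type) $\mid \mathsf{ref.func}\,x \mid \mathsf{throw}\,x \mid \mathsf{cont.new}_{ft} \mid \mathsf{resume}_{ft}\,h^*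 \mid \mathsf{resume\_throw}_{ft}\,x\,h^* \mid \mathsf{suspend}\,x \mid \mathsf{cont.bind}_{ft,ft'}$. Functions: $\mathsf{func}\,ft\,\mathsf{local}\,t^*\,e^*$. Tags: $\mathsf{tag}\,ft$. Administrative instructions additionally include $\mathsf{ref.cont}\,k$ ($k$ a continuation address), $\mathsf{trap}$, $\mathsf{label}_n\{e^*\}\,e^*$, $\mathsf{frame}_n\{F\}\,e^*$, $\mathsf{handler}\{h^*\}\,e^*$. Values $v$ are constants, $\mathsf{ref.null}_t$, $\mathsf{ref.func}\,x$, $\mathsf{ref.cont}\,k$. A frame $F$ is a sequence of values (the locals). A store $s$ has components $s_{\mathsf{func}}$ (list of functions), $s_{\mathsf{tag}}$ (list of function types of tags), and $s_{\mathsf{cont}}$ (a finite map from addresses to continuations); a continuation is an evaluation context $E$ or the token $\mathsf{dead}$. $s[k=\cdot]$ is update, $s[+k=\cdot]$ extension at a fresh address $k$; $F[x=v]$ is update of local $x$. Evaluation contexts: $E ::= [\,] \mid v^*\,E\,e^* \mid \mathsf{label}_n\{e^*\}\,E \mid \mathsf{frame}_n\{F\}\,E \mid \mathsf{handler}\{h^*\}\,E$. $E^x$ ranges over evaluation contexts in which no $\mathsf{handler}\{h^*\}$ on the path to the hole has a clause for tag $x$. $L$ ranges over evaluation contexts with no $\mathsf{frame}$ on the path to the hole. $B^l$ ranges over contexts $L$ with exactly $l$ $\mathsf{label}$s (and possibly handlers) on the path to the hole. Holes are filled by splicing instruction sequences. **Typing of instructions.** Contexts $C$ record types of functions, tags,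 locals, and result types $t^*$ of labels (lookups $C_{\mathsf{func}}(x)$, $C_{\mathsf{tag}}(x)$, $C_{\mathsf{local}}(x)$, $C_{\mathsf{label}}(l)$); ''$C,\mathsf{label}\,t^*$'' adds a new innermost label. The judgement $s;C\vdash e^*:t_1^*\to t_2^*$ is the least one closed under the following rules. - Sequences: $\epsilon:\epsilon\to\epsilon$; if $e_1^*:t_1^*\to t_2^*$ and $e_2:t_2^*\to t_3^*$ then $e_1^*\,e_2:t_1^*\to t_3^*$; if $e^*:t_1^*\to t_2^*$ then $e^*:t^*t_1^*\to t^*t_2^*$. - $t.\mathsf{const}\,c:\epsilon\to t$; $\mathsf{local.get}\,x:\epsilon\to t$ and $\mathsf{local.set}\,x:t\to\epsilon$ if $C_{\mathsf{local}}(x)=t$. - With $ft=t_1^*\to t_2^*$: $\mathsf{block}_{ft}\,e^*:ft$ if $C,\mathsf{label}\,t_2^*\vdash e^*:ft$; $\mathsf{loop}_{ft}\,e^*:ft$ if $C,\mathsf{label}\,t_1^*\vdash e^*:ft$. - If $C_{\mathsf{label}}(l)=t^*$: $\mathsf{br}\,l:t_1^*t^*\to t_2^*$ for any $t_1^*,t_2^*$; $\mathsf{br\_if}\,l:t^*\,\mathsf{i32}\to t^*$. - $\mathsf{call\_ref}_{ft}:t_1^*\,(\mathsf{ref}\,ft)\to t_2^*$ for $ft=t_1^*\to t_2^*$; $\mathsf{ref.null}_t:\epsilon\to t$; $\mathsf{ref.func}\,x:\epsilon\to\mathsf{ref}\,ft$ if $C_{\mathsf{func}}(x)=ft$. - $\mathsf{throw}\,x:t_1^*t^*\to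 t_2^*$ for any $t_1^*,t_2^*$, if $C_{\mathsf{tag}}(x)=t^*\to\epsilon$. - $\mathsf{cont.new}_{ft}:(\mathsf{ref}\,ft)\to(\mathsf{ref\,cont}\,ft)$. - $C\vdash\mathsf{on}\,x\,l:t_2^*\ \text{clause}$ if $C_{\mathsf{tag}}(x)={t_1'}^*\to{t_2'}^*$ and $C_{\mathsf{label}}(l)={t_1'}^*\,(\mathsf{ref\,cont}\,({t_2'}^*\to t_2^* ))$. - For $ft=t_1^*\to t_2^*$ and $(C\vdash h:t_2^*\ \text{clause})^*$: $\mathsf{resume}_{ft}\,h^*:t_1^*\,(\mathsf{ref\,cont}\,ft)\to t_2^*$; and if $C_{\mathsf{tag}}(x)={t'}^*\to\epsilon$ then $\mathsf{resume\_throw}_{ft}\,x\,h^*:{t'}^*\,(\mathsf{ref\,cont}\,ft)\to t_2^*$. - $\mathsf{suspend}\,x:t_1^*\to t_2^*$ if $C_{\mathsf{tag}}(x)=t_1^*\to t_2^*$. - $\mathsf{cont.bind}_{ft,ft'}:t^*\,(\mathsf{ref\,cont}\,ft)\to(\mathsf{ref\,cont}\,ft')$ if $ft=t^*t_1^*\to t_2^*$ and $ft'=t_1^*\to t_2^*$. - Administrative: $\mathsf{trap}:t_1^*\to t_2^*$ for any types. $\mathsf{ref.cont}\,k:\epsilon\to\mathsf{ref\,cont}\,ft$ if $s\vdash s_{\mathsf{cont}}(k):ft$. $\mathsf{label}_n\{e_0^*\}\,e^*:\epsilon\to t_2^*$ if $s;C\vdash e_0^*:t_1^n\to t_2^*$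 and $s;C,\mathsf{label}\,t_1^n\vdash e^*:\epsilon\to t_2^*$. $\mathsf{frame}_n\{F\}\,e^*:\epsilon\to t^n$ if the values of $F$ have types $t_l^*$ and $s;C_s,\mathsf{local}\,t_l^*\vdash e^*:\epsilon\to t^n$. $\mathsf{handler}\{h^*\}\,e^*:\epsilon\to t^*$ if $(C\vdash h:t^*\ \text{clause})^*$ and $s;C^\circ\vdash e^*:\epsilon\to t^*$, where $C^\circ$ is $C$ with all locals and labels removed. Here $C_s$ contains exactly the function types of $s_{\mathsf{func}}$ and the tag types of $s_{\mathsf{tag}}$ (no locals, no labels). Continuation typing: $s\vdash\mathsf{dead}:ft$ for every $ft$; $s\vdash E:t_1^*\to t_2^*$ if $s;C_s\vdash E[\square]:\epsilon\to t_2^*$, where $\square$ is a placeholder instruction having type $\epsilon\to t_1^*$ in every context. (All these judgements are defined by simultaneous induction.) **Stores and configurations.** $\vdash s\ \text{ok}$ if every function $\mathsf{func}\,(t_1^*\to t_2^* )\,\mathsf{local}\,t^*\,e^*$ in $s_{\mathsf{func}}$ (with $e^*$ non-administrative) satisfies $C_s,\mathsf{local}\,t_1^*t^*,\mathsf{label}\,t_2^*\vdash e^*:\epsilon\to t_2^*$, and every continuation in $s_{\mathsf{cont}}$ has some type. $\vdash s;F;e^*:t^*$ if $\vdash s\ \text{ok}$, the values in $F$ have some types $t_l^*$ under $s$, and $s;C_s,\mathsf{local}\,t_l^*\vdash e^*:\epsilon\to t^*$. **Reduction** $s;F;e^*\hookrightarrow s';F';{e'}^*$ (unmentioned components are unchanged):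 - $F;\mathsf{local.get}\,x\hookrightarrow F;F(x)$; $F;v\,(\mathsf{local.set}\,x)\hookrightarrow F[x=v];\epsilon$. - $v^n\,\mathsf{block}_{t_1^n\to t_2^m}\,e^*\hookrightarrow\mathsf{label}_m\{\epsilon\}\,v^n e^*$; $v^n\,\mathsf{loop}_{t_1^n\to t_2^m}\,e^*\hookrightarrow\mathsf{label}_n\{\mathsf{loop}_{t_1^n\to t_2^m}\,e^*\}\,v^n e^*$. - $\mathsf{label}_n\{e^*\}\,v^*\hookrightarrow v^*$; $\mathsf{label}_n\{e^*\}\,B^l[v^n\,(\mathsf{br}\,l)]\hookrightarrow v^n\,e^*$. - $(\mathsf{i32.const}\,0)\,(\mathsf{br\_if}\,l)\hookrightarrow\epsilon$; $(\mathsf{i32.const}\,c)\,(\mathsf{br\_if}\,l)\hookrightarrow\mathsf{br}\,l$ for $c\neq0$. - $v^n\,(\mathsf{ref.func}\,x)\,\mathsf{call\_ref}_{ft}\hookrightarrow\mathsf{frame}_m\{v^n\,v_0^*\}\,(\mathsf{label}_m\{\epsilon\}\,e^* )$ if $s_{\mathsf{func}}(x)=\mathsf{func}\,(t_1^n\to t_2^m)\,\mathsf{local}\,t^*\,e^*$ and $v_0^*$ are the default values of $t^*$ (zero, or null for references). $\mathsf{frame}_n\{F\}\,v^n\hookrightarrow v^n$. - $s;(\mathsf{ref.func}\,x)\,\mathsf{cont.new}_{ft}\hookrightarrow s[+k=E];\mathsf{ref.cont}\,k$ with $E=[\,]\,(\mathsf{ref.func}\,x)\,\mathsf{call\_ref}_{ft}$.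 - $s;v^n\,(\mathsf{ref.cont}\,k)\,(\mathsf{resume}_{t_1^n\to t_2^m}\,h^* )\hookrightarrow s[k=\mathsf{dead}];\mathsf{handler}\{h^*\}\,E[v^n]$ if $s_{\mathsf{cont}}(k)=E$. - $s;v^n\,(\mathsf{ref.cont}\,k)\,(\mathsf{resume\_throw}_{ft}\,x\,h^* )\hookrightarrow s[k=\mathsf{dead}];\mathsf{handler}\{h^*\}\,E[v^n\,(\mathsf{throw}\,x)]$ if $s_{\mathsf{cont}}(k)=E$ and tag $x$ has $n$ parameters. - $s;v^n\,(\mathsf{ref.cont}\,k)\,\mathsf{cont.bind}_{ft,ft'}\hookrightarrow s[k=\mathsf{dead}][+k'=E[v^n\,[\,]]];\mathsf{ref.cont}\,k'$ if $s_{\mathsf{cont}}(k)=E$ and $ft$ has $n$ more parameters than $ft'$. - $\mathsf{handler}\{h^*\}\,v^*\hookrightarrow v^*$. - $s;\mathsf{handler}\{h^*\}\,E^x[v^n\,(\mathsf{suspend}\,x)]\hookrightarrow s[+k=E^x];v^n\,(\mathsf{ref.cont}\,k)\,(\mathsf{br}\,l)$ if tag $x$ has $n$ parameters and $\mathsf{on}\,x\,l$ is the first clause for $x$ in $h^*$. - $\mathsf{call\_ref}$, $\mathsf{cont.new}$, $\mathsf{resume}$, $\mathsf{resume\_throw}$, $\mathsf{cont.bind}$ immediately preceded by a null reference, and $\mathsf{resume}$, $\mathsf{resume\_throw}$, $\mathsf{cont.bind}$ immediately preceded by $\mathsf{ref.cont}\,k$ with $s_{\mathsf{cont}}(k)=\mathsf{dead}$,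 reduce (together with that reference) to $\mathsf{trap}$. - $E[\mathsf{trap}]\hookrightarrow\mathsf{trap}$ if $E\neq[\,]$. - If $s;F;e^*\hookrightarrow s';F';{e'}^*$ then $s;F;L[e^*]\hookrightarrow s';F';L[{e'}^*]$, and for every frame $F_0$, $s;F_0;\mathsf{frame}_n\{F\}\,e^*\hookrightarrow s';F_0;\mathsf{frame}_n\{F'\}\,{e'}^*$. *)

(* Defs.v *)
From Stdlib Require List.
From mathcomp Require Import all_boot.
From mathcomp Require Import finmap.

Set Implicit Arguments.
Unset Strict Implicit.
Unset Printing Implicit Defensive.

Local Open Scope fmap_scope.

Inductive numtype := I32 | I64.

Inductive valtype :=
  | TNum of numtype
  | TRef of reftype
with reftype :=
  | RFunc of functype
  | RCont of functype
with functype :=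
  | Arr of seq valtype & seq valtype.

Notation "t1 ~> t2" := (Arr t1 t2) (at level 70, no associativity).
Notation t_i32 := (TNum I32).
Notation t_ref ft := (TRef (RFunc ft)).
Notation t_cont ft := (TRef (RCont ft)).

Definition params (ft : functype) : seq valtype := let: t1 ~> _ := ft in t1.

(* The constants of i32 and i64 are the bit strings of that width. *)
Definition width (t : numtype) : nat :=
  match t with I32 => 32 | I64 => 64 end.
Definition word (n : nat) := n.-tuple bool.
Definition word0 (n : nat) : word n := nseq_tuple n false.

Inductive value :=
  | VConst (t : numtype) (c : word (width t))
  | VNull (t : reftype)
  | VFunc (x : nat)
  | VCont (k : nat).

Definition default (t : valtype) : value :=
  match t with
  | TNum n => VConst (word0 (width n))
  | TRef r => VNull r
  end.

(* A frame is the sequence of its locals. *)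
Definition frame := seq value.

(* The handler clause [on x l]. *)
Inductive clause := On (x l : nat).

(* Value instructions are exactly the [IVal v]; [ref.cont k], that is
   [IVal (VCont k)], is administrative.  [IPlaceholder] is the symbol used to
   type evaluation contexts; it is not an instruction of the language, and
   cannot be typed in programs (see [e_typing]). *)
Inductive instr :=
  | IVal (v : value)
  | ILocalGet (x : nat)
  | ILocalSet (x : nat)
  | IBlock (ft : functype) (es : seq instr)
  | ILoop (ft : functype) (es : seq instr)
  | IBr (l : nat)
  | IBrIf (l : nat)
  | ICallRef (ft : functype)
  | IThrow (x : nat)
  | IContNew (ft : functype)
  | IResume (ft : functype) (hs : seq clause)
  | IResumeThrow (ft : functype) (x : nat) (hs : seq clause)
  | ISuspend (x : nat)
  | IContBind (ft ft' : functype)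
  | ITrap
  | ILabel (n : nat) (es0 es : seq instr)
  | IFrame (n : nat) (F : frame) (es : seq instr)
  | IHandler (hs : seq clause) (es : seq instr)
  | IPlaceholder.

Definition vals (vs : seq value) : seq instr := map IVal vs.

Fixpoint non_admin (e : instr) : bool :=
  match e with
  | IVal (VCont _) | ITrap | ILabel _ _ _ | IFrame _ _ _ | IHandler _ _
  | IPlaceholder => false
  | IBlock _ es | ILoop _ es => all non_admin es
  | _ => true
  end.

Fixpoint placeholder_free (e : instr) : bool :=
  match e with
  | IPlaceholder => false
  | IBlock _ es | ILoop _ es | IFrame _ _ es | IHandler _ es =>
      all placeholder_free es
  | ILabel _ es0 es => all placeholder_free es0 && all placeholder_free es
  | _ => true
  end.

Inductive ectx :=
  | EHole
  | ESeq (vs : seq value) (E : ectx) (es : seq instr)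
  | ELabel (n : nat) (es0 : seq instr) (E : ectx)
  | EFrame (n : nat) (F : frame) (E : ectx)
  | EHandler (hs : seq clause) (E : ectx).

Fixpoint fill (E : ectx) (es : seq instr) : seq instr :=
  match E with
  | EHole => es
  | ESeq vs E' es' => vals vs ++ fill E' es ++ es'
  | ELabel n es0 E' => [:: ILabel n es0 (fill E' es)]
  | EFrame n F E' => [:: IFrame n F (fill E' es)]
  | EHandler hs E' => [:: IHandler hs (fill E' es)]
  end.

Fixpoint ecomp (E E1 : ectx) : ectx :=
  match E with
  | EHole => E1
  | ESeq vs E' es' => ESeq vs (ecomp E' E1) es'
  | ELabel n es0 E' => ELabel n es0 (ecomp E' E1)
  | EFrame n F E' => EFrame n F (ecomp E' E1)
  | EHandler hs E' => EHandler hs (ecomp E' E1)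
  end.

(* [E] is the empty context [ ]: as a sequence with a hole, the context
   v* [ ] e* with empty v* and e* is also [ ]. *)
Fixpoint is_hole (E : ectx) : bool :=
  match E with
  | EHole => true
  | ESeq [::] E' [::] => is_hole E'
  | _ => false
  end.

Fixpoint ectx_placeholder_free (E : ectx) : bool :=
  match E with
  | EHole => true
  | ESeq _ E' es => ectx_placeholder_free E' && all placeholder_free es
  | ELabel _ es0 E' => all placeholder_free es0 && ectx_placeholder_free E'
  | EFrame _ _ E' | EHandler _ E' => ectx_placeholder_free E'
  end.

(* The label of the first clause for tag [x]. *)
Fixpoint find_clause (x : nat) (hs : seq clause) : option nat :=
  match hs with
  | [::] => None
  | On y l :: hs' => if x == y then Some l else find_clause x hs'
  end.

(* [E] is of the form E^x. *)
Fixpoint unhandled (x : nat) (E : ectx) : bool :=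
  match E with
  | EHole => true
  | ESeq _ E' _ | ELabel _ _ E' | EFrame _ _ E' => unhandled x E'
  | EHandler hs E' => (find_clause x hs == None) && unhandled x E'
  end.

(* [E] is of the form L. *)
Fixpoint frameless (E : ectx) : bool :=
  match E with
  | EHole => true
  | ESeq _ E' _ | ELabel _ _ E' | EHandler _ E' => frameless E'
  | EFrame _ _ _ => false
  end.

Fixpoint label_depth (E : ectx) : nat :=
  match E with
  | EHole => 0
  | ESeq _ E' _ | EFrame _ _ E' | EHandler _ E' => label_depth E'
  | ELabel _ _ E' => (label_depth E').+1
  end.

(* [E] is of the form B^l. *)
Definition br_ctx (l : nat) (E : ectx) : bool :=
  frameless E && (label_depth E == l).

Record func := Func {
  func_type : functype;
  func_locals : seq valtype;
  func_body : seq instr }.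

Inductive continuation :=
  | Cont of ectx
  | Dead.

Record store := Store {
  s_func : seq func;
  s_tag : seq functype;
  s_cont : {fmap nat -> continuation} }.

(* Both s[k = K] and, when [k] is fresh for [s], s[+k = K]. *)
Definition set_cont (s : store) (k : nat) (K : continuation) : store :=
  Store (s_func s) (s_tag s) (s_cont s).[k <- K].

Definition fresh (s : store) (k : nat) : Prop := (s_cont s).[? k] = None.

(* The head of [c_label] is the innermost label. *)
Record context := Context {
  c_func : seq functype;
  c_tag : seq functype;
  c_local : seq valtype;
  c_label : seq (seq valtype) }.

Definition add_label (C : context) (ts : seq valtype) : context :=
  Context (c_func C) (c_tag C) (c_local C) (ts :: c_label C).

Definition add_locals (C : context) (ts : seq valtype) : context :=
  Context (c_func C) (c_tag C) (c_local C ++ ts) (c_label C).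

(* C° *)
Definition strip (C : context) : context :=
  Context (c_func C) (c_tag C) [::] [::].

(* C_s *)
Definition store_ctx (s : store) : context :=
  Context (map func_type (s_func s)) (s_tag s) [::] [::].

Definition clause_typing (C : context) (ts : seq valtype) (h : clause) : Prop :=
  let: On x l := h in
  exists t1' t2' : seq valtype,
    onth (c_tag C) x = Some (t1' ~> t2') /\
    onth (c_label C) l = Some (t1' ++ [:: t_cont (t2' ~> ts)]).

Definition clauses_typing (C : context) (ts : seq valtype) (hs : seq clause) :=
  List.Forall (clause_typing C ts) hs.

(* [e_typing s C P es ft] is s; C |- es : ft, where [P] is the result type of
   the placeholder: [Some t1] while the context of a continuation is being
   typed with a placeholder of type [::] ~> t1, and [None] otherwise, in which
   case the placeholder has no type. *)
Inductive e_typing (s : store) :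
    context -> option (seq valtype) -> seq instr -> functype -> Prop :=
  | T_empty C P :
      e_typing s C P [::] ([::] ~> [::])
  | T_seq C P es e t1 t2 t3 :
      e_typing s C P es (t1 ~> t2) ->
      e_typing s C P [:: e] (t2 ~> t3) ->
      e_typing s C P (es ++ [:: e]) (t1 ~> t3)
  | T_weaken C P es ts t1 t2 :
      e_typing s C P es (t1 ~> t2) ->
      e_typing s C P es (ts ++ t1 ~> ts ++ t2)
  | T_const C P n (c : word (width n)) :
      e_typing s C P [:: IVal (VConst c)] ([::] ~> [:: TNum n])
  | T_local_get C P x t :
      onth (c_local C) x = Some t ->
      e_typing s C P [:: ILocalGet x] ([::] ~> [:: t])
  | T_local_set C P x t :
      onth (c_local C) x = Some t ->
      e_typing s C P [:: ILocalSet x] ([:: t] ~> [::])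
  | T_block C P es t1 t2 :
      e_typing s (add_label C t2) P es (t1 ~> t2) ->
      e_typing s C P [:: IBlock (t1 ~> t2) es] (t1 ~> t2)
  | T_loop C P es t1 t2 :
      e_typing s (add_label C t1) P es (t1 ~> t2) ->
      e_typing s C P [:: ILoop (t1 ~> t2) es] (t1 ~> t2)
  | T_br C P l ts t1 t2 :
      onth (c_label C) l = Some ts ->
      e_typing s C P [:: IBr l] (t1 ++ ts ~> t2)
  | T_br_if C P l ts :
      onth (c_label C) l = Some ts ->
      e_typing s C P [:: IBrIf l] (ts ++ [:: t_i32] ~> ts)
  | T_call_ref C P t1 t2 :
      e_typing s C P [:: ICallRef (t1 ~> t2)] (t1 ++ [:: t_ref (t1 ~> t2)] ~> t2)
  | T_ref_null C P t :
      e_typing s C P [:: IVal (VNull t)] ([::] ~> [:: TRef t])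
  | T_ref_func C P x ft :
      onth (c_func C) x = Some ft ->
      e_typing s C P [:: IVal (VFunc x)] ([::] ~> [:: t_ref ft])
  | T_throw C P x ts t1 t2 :
      onth (c_tag C) x = Some (ts ~> [::]) ->
      e_typing s C P [:: IThrow x] (t1 ++ ts ~> t2)
  | T_cont_new C P ft :
      e_typing s C P [:: IContNew ft] ([:: t_ref ft] ~> [:: t_cont ft])
  | T_resume C P hs t1 t2 :
      clauses_typing C t2 hs ->
      e_typing s C P [:: IResume (t1 ~> t2) hs]
        (t1 ++ [:: t_cont (t1 ~> t2)] ~> t2)
  | T_resume_throw C P x hs ts' t1 t2 :
      clauses_typing C t2 hs ->
      onth (c_tag C) x = Some (ts' ~> [::]) ->
      e_typing s C P [:: IResumeThrow (t1 ~> t2) x hs]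
        (ts' ++ [:: t_cont (t1 ~> t2)] ~> t2)
  | T_suspend C P x t1 t2 :
      onth (c_tag C) x = Some (t1 ~> t2) ->
      e_typing s C P [:: ISuspend x] (t1 ~> t2)
  | T_cont_bind C P ts t1 t2 :
      e_typing s C P [:: IContBind (ts ++ t1 ~> t2) (t1 ~> t2)]
        (ts ++ [:: t_cont (ts ++ t1 ~> t2)] ~> [:: t_cont (t1 ~> t2)])
  | T_trap C P t1 t2 :
      e_typing s C P [:: ITrap] (t1 ~> t2)
  | T_ref_cont C P k K ft :
      (s_cont s).[? k] = Some K ->
      cont_typing s K ft ->
      e_typing s C P [:: IVal (VCont k)] ([::] ~> [:: t_cont ft])
  | T_label C P n es0 es t1 t2 :
      size t1 = n ->
      e_typing s C P es0 (t1 ~> t2) ->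
      e_typing s (add_label C t1) P es ([::] ~> t2) ->
      e_typing s C P [:: ILabel n es0 es] ([::] ~> t2)
  | T_frame C P n F es tl ts :
      size ts = n ->
      vals_typing s F tl ->
      e_typing s (add_locals (store_ctx s) tl) P es ([::] ~> ts) ->
      e_typing s C P [:: IFrame n F es] ([::] ~> ts)
  | T_handler C P hs es ts :
      clauses_typing C ts hs ->
      e_typing s (strip C) P es ([::] ~> ts) ->
      e_typing s C P [:: IHandler hs es] ([::] ~> ts)
  | T_placeholder C ts :
      e_typing s C (Some ts) [:: IPlaceholder] ([::] ~> ts)

with vals_typing (s : store) : seq value -> seq valtype -> Prop :=
  | T_vals_nil :
      vals_typing s [::] [::]
  | T_vals_cons v vs t ts :
      e_typing s (store_ctx s) None [:: IVal v] ([::] ~> [:: t]) ->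
      vals_typing s vs ts ->
      vals_typing s (v :: vs) (t :: ts)

(* The side condition says that [E] is a context of the language proper: the
   only placeholder of E[placeholder] is the one in the hole. *)
with cont_typing (s : store) : continuation -> functype -> Prop :=
  | T_dead ft :
      cont_typing s Dead ft
  | T_ectx E t1 t2 :
      ectx_placeholder_free E ->
      e_typing s (store_ctx s) (Some t1) (fill E [:: IPlaceholder])
        ([::] ~> t2) ->
      cont_typing s (Cont E) (t1 ~> t2).

Definition func_ok (s : store) (f : func) : Prop :=
  let: t1 ~> t2 := func_type f in
  all non_admin (func_body f) /\
  e_typing s
    (add_label (add_locals (store_ctx s) (t1 ++ func_locals f)) t2) None
    (func_body f) ([::] ~> t2).

Definition store_ok (s : store) : Prop :=
  List.Forall (func_ok s) (s_func s) /\
  (forall k K, (s_cont s).[? k] = Some K -> exists ft, cont_typing s K ft).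

Definition config_typing (s : store) (F : frame) (es : seq instr)
    (ts : seq valtype) : Prop :=
  store_ok s /\
  exists tl : seq valtype,
    vals_typing s F tl /\
    e_typing s (add_locals (store_ctx s) tl) None es ([::] ~> ts).

Definition null_traps (e : instr) : bool :=
  match e with
  | ICallRef _ | IContNew _ | IResume _ _ | IResumeThrow _ _ _
  | IContBind _ _ => true
  | _ => false
  end.

Definition dead_traps (e : instr) : bool :=
  match e with
  | IResume _ _ | IResumeThrow _ _ _ | IContBind _ _ => true
  | _ => false
  end.

Inductive step : store -> frame -> seq instr ->
                 store -> frame -> seq instr -> Prop :=
  | R_local_get s F x v :
      onth F x = Some v ->
      step s F [:: ILocalGet x] s F [:: IVal v]
  | R_local_set s F x v :
      x < size F ->
      step s F [:: IVal v; ILocalSet x] s (set_nth v F x v) [::]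
  | R_block s F vs t1 t2 es :
      size vs = size t1 ->
      step s F (vals vs ++ [:: IBlock (t1 ~> t2) es])
           s F [:: ILabel (size t2) [::] (vals vs ++ es)]
  | R_loop s F vs t1 t2 es :
      size vs = size t1 ->
      step s F (vals vs ++ [:: ILoop (t1 ~> t2) es])
           s F [:: ILabel (size t1) [:: ILoop (t1 ~> t2) es] (vals vs ++ es)]
  | R_label s F n es vs :
      step s F [:: ILabel n es (vals vs)] s F (vals vs)
  | R_br s F n es l B vs :
      br_ctx l B ->
      size vs = n ->
      step s F [:: ILabel n es (fill B (vals vs ++ [:: IBr l]))]
           s F (vals vs ++ es)
  | R_br_if_false s F l :
      step s F [:: IVal (@VConst I32 (word0 32)); IBrIf l] s F [::]
  | R_br_if_true s F (c : word 32) l :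
      c <> word0 32 ->
      step s F [:: IVal (@VConst I32 c); IBrIf l] s F [:: IBr l]
  | R_call_ref s F vs x ft t1 t2 tl es :
      onth (s_func s) x = Some (Func (t1 ~> t2) tl es) ->
      size vs = size t1 ->
      step s F (vals vs ++ [:: IVal (VFunc x); ICallRef ft])
           s F [:: IFrame (size t2) (vs ++ map default tl)
                     [:: ILabel (size t2) [::] es]]
  | R_frame s F n F1 vs :
      size vs = n ->
      step s F [:: IFrame n F1 (vals vs)] s F (vals vs)
  | R_cont_new s F x ft k :
      fresh s k ->
      step s F [:: IVal (VFunc x); IContNew ft]
           (set_cont s k
              (Cont (ESeq [::] EHole [:: IVal (VFunc x); ICallRef ft])))
           F [:: IVal (VCont k)]
  | R_resume s F vs k t1 t2 hs E :
      (s_cont s).[? k] = Some (Cont E) ->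
      size vs = size t1 ->
      step s F (vals vs ++ [:: IVal (VCont k); IResume (t1 ~> t2) hs])
           (set_cont s k Dead) F [:: IHandler hs (fill E (vals vs))]
  | R_resume_throw s F vs k ft x hs E tag :
      (s_cont s).[? k] = Some (Cont E) ->
      onth (s_tag s) x = Some tag ->
      size vs = size (params tag) ->
      step s F (vals vs ++ [:: IVal (VCont k); IResumeThrow ft x hs])
           (set_cont s k Dead) F
           [:: IHandler hs (fill E (vals vs ++ [:: IThrow x]))]
  | R_cont_bind s F vs k ft ft' E k' :
      (s_cont s).[? k] = Some (Cont E) ->
      size (params ft) = size vs + size (params ft') ->
      fresh (set_cont s k Dead) k' ->
      step s F (vals vs ++ [:: IVal (VCont k); IContBind ft ft'])
           (set_cont (set_cont s k Dead) k'
              (Cont (ecomp E (ESeq vs EHole [::]))))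
           F [:: IVal (VCont k')]
  | R_handler s F hs vs :
      step s F [:: IHandler hs (vals vs)] s F (vals vs)
  | R_suspend s F hs E x vs tag l k :
      unhandled x E ->
      onth (s_tag s) x = Some tag ->
      size vs = size (params tag) ->
      find_clause x hs = Some l ->
      fresh s k ->
      step s F [:: IHandler hs (fill E (vals vs ++ [:: ISuspend x]))]
           (set_cont s k (Cont E)) F
           (vals vs ++ [:: IVal (VCont k); IBr l])
  | R_null s F t e :
      null_traps e ->
      step s F [:: IVal (VNull t); e] s F [:: ITrap]
  | R_dead s F k e :
      dead_traps e ->
      (s_cont s).[? k] = Some Dead ->
      step s F [:: IVal (VCont k); e] s F [:: ITrap]
  | R_trap s F E :
      ~~ is_hole E ->
      step s F (fill E [:: ITrap]) s F [:: ITrap]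
  | R_ctx s F es s' F' es' L :
      frameless L ->
      step s F es s' F' es' ->
      step s F (fill L es) s' F' (fill L es')
  | R_frame_ctx s F es s' F' es' n F0 :
      step s F es s' F' es' ->
      step s F0 [:: IFrame n F es] s' F0 [:: IFrame n F' es'].

Inductive is_result : seq instr -> Prop :=
  | Res_vals vs : is_result (vals vs)
  | Res_trap : is_result [:: ITrap]
  | Res_throw E x : is_result (fill E [:: IThrow x])
  | Res_suspend E x : unhandled x E -> is_result (fill E [:: ISuspend x]).

(* Main.v *)
Require Import Defs.
From mathcomp Require Import all_boot.
From mathcomp Require Import finmap.

Set Implicit Arguments.
Unset Strict Implicit.
Unset Printing Implicit Defensive.

(** Progress is proved for open configurations: for a derivation of
    es : t1 -> t2 and values vs of types t1, the sequence vs es is either a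
    sequence of values of types t2 or active, that is, it is a trap, it reduces,
    or it is blocked on a throw, on a suspension that no enclosing handler
    catches, or on a branch whose target label lies outside.  Suspensions and
    branches carry their operands, so that the enclosing handler or label can
    fire.  A handler hides the outer labels from its body and a frame starts
    with none, hence no branch ever escapes through either of them. *)

(** * Contexts and fresh addresses *)

Lemma vals_cat vs1 vs2 : vals (vs1 ++ vs2) = vals vs1 ++ vals vs2.
Proof. exact: map_cat. Qed.

Lemma exists_fresh s : exists k, fresh s k.
Proof.
exists (\max_(i <- enum_fset (domf (s_cont s))) i).+1.
apply: not_fnd; apply/negP => dom_k.
by have := @leq_bigmax_seq _ _ xpredT id _ dom_k isT; rewrite ltnn.
Qed.

Lemma fill_ecomp E E1 es : fill (ecomp E E1) es = fill E (fill E1 es).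
Proof. by elim: E => //= [vs E -> |n es0 E ->|n F E ->|hs E ->]. Qed.

Lemma unhandled_ecomp x E E1 :
  unhandled x (ecomp E E1) = unhandled x E && unhandled x E1.
Proof. by elim: E => //= hs E ->; rewrite andbA. Qed.

Section Typing.
Variable s : store.

(** * Inversion of value typing *)

Definition no_effect (ft : functype) := let: t1 ~> t2 := ft in t1 = t2.

(** [T_seq] also derives [[:: e]], as an empty prefix followed by [e]; inverting the typing of a
    single value must know that this prefix changes no type. *)
Lemma e_typing_nil C P es ft : e_typing s C P es ft -> es = [::] -> no_effect ft.
Proof. by elim => //= {C P es ft}; [move=> C P [] | move=> C P es ts t1 t2 _ IH /IH <-]. Qed.

(** Only what canonical forms need is kept: a continuation address must be allocated, with no link
    between its type and the stored continuation. *)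
Definition value_type (C : context) (v : value) (t : valtype) : Prop :=
  match v with
  | @VConst n _ => t = TNum n
  | VNull r => t = TRef r
  | VFunc x => exists2 ft, onth (c_func C) x = Some ft & t = t_ref ft
  | VCont k => exists2 K, (s_cont s).[? k]%fmap = Some K & exists ft, t = t_cont ft
  end.

Definition pushes (C : context) (v : value) (ft : functype) : Prop :=
  let: t1 ~> t2 := ft in exists2 t, value_type C v t & t2 = t1 ++ [:: t].

Lemma e_typing_val C P es ft v :
  e_typing s C P es ft -> es = [:: IVal v] -> pushes C v ft.
Proof.
elim=> //= {C P es ft}.
- move=> C P es e t1 t2 t3 typ_es _ _ IH.
  case: es typ_es => [/e_typing_nil/(_ erefl)/= -> /= /IH //|e1 es _].
  by case: es.
- by move=> C P es ts t1 t2 _ IH /IH[t vt ->]; exists t; rewrite // catA.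
- by move=> C _ n c [<-]; exists (TNum n).
- by move=> C _ t [<-]; exists (TRef t).
- by move=> C _ x ft def_ft [<-]; exists (t_ref ft) => //; exists ft.
- by move=> C _ k K ft def_K _ [<-]; exists (t_cont ft) => //; exists K => //; exists ft.
Qed.

(** * Typed operand stacks *)

Lemma vals_typing_size vs ts : vals_typing s vs ts -> size vs = size ts.
Proof. by elim=> //= v vs' t ts' _ _ ->. Qed.

Lemma vals_typing1 v t :
  e_typing s (store_ctx s) None [:: IVal v] ([::] ~> [:: t]) ->
  vals_typing s [:: v] [:: t].
Proof. by move=> typ_v; apply: T_vals_cons typ_v (T_vals_nil s). Qed.

Lemma vals_typing_cat vs1 vs2 ts1 ts2 :
  vals_typing s vs1 ts1 -> vals_typing s vs2 ts2 ->
  vals_typing s (vs1 ++ vs2) (ts1 ++ ts2).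
Proof. by elim=> //= v vs t ts typ_v _ IH /IH; apply: T_vals_cons. Qed.

Lemma vals_typing_split vs ts1 ts2 :
  vals_typing s vs (ts1 ++ ts2) ->
  exists vs1 vs2, [/\ vs = vs1 ++ vs2, vals_typing s vs1 ts1
                    & vals_typing s vs2 ts2].
Proof.
elim: ts1 vs => [|t ts1 IH] vs /= typ_vs.
  by exists [::], vs; split=> //; apply: T_vals_nil.
inversion_clear typ_vs as [|v vs' t' ts typ_v typ_vs'].
have [vs1 [vs2 [-> typ1 typ2]]] := IH _ typ_vs'.
by exists (v :: vs1), vs2; split=> //; apply: T_vals_cons.
Qed.

(** Exposes the top operand, whose shape decides which reduction rule applies. *)
Lemma vals_typing_rcons vs ts t :
  vals_typing s vs (ts ++ [:: t]) ->
  exists vs' v, [/\ vs = vs' ++ [:: v], vals_typing s vs' ts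
                  & value_type (store_ctx s) v t].
Proof.
case/vals_typing_split=> vs' [vs2 [-> typ_vs' typ2]].
inversion_clear typ2 as [|v vs3 t' ts' typ_v typ3]; inversion_clear typ3.
have [t' vt [->]] := e_typing_val typ_v erefl.
by exists vs', v.
Qed.

(** * Active sequences inside evaluation contexts *)

(** In [Act_br], [l] is counted from outside [E] and indexes the labels of [C]; the index of the
    instruction adds the labels that [E] crosses. A throw carries no operands, as no rule catches
    it. *)
Inductive active (F : frame) (C : context) : seq instr -> Prop :=
  | Act_trap : active F C [:: ITrap]
  | Act_step es s' F' es' : step s F es s' F' es' -> active F C es
  | Act_throw E x : active F C (fill E [:: IThrow x])
  | Act_suspend E vs x tag :
      unhandled x E -> onth (s_tag s) x = Some tag ->
      size vs = size (params tag) ->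
      active F C (fill E (vals vs ++ [:: ISuspend x]))
  | Act_br E vs l ts :
      frameless E -> onth (c_label C) l = Some ts -> size vs = size ts ->
      active F C (fill E (vals vs ++ [:: IBr (label_depth E + l)])).

Lemma active_seq F C vs es es' :
  active F C es -> active F C (vals vs ++ es ++ es').
Proof.
rewrite -[_ ++ _]/(fill (ESeq vs EHole es') es); case=> {es}.
(* [R_trap] excludes the empty context; there the whole sequence is the trap itself. *)
- have [|] := boolP (is_hole (ESeq vs EHole es')); last first.
    by move=> nhole; apply: Act_step (R_trap _ _ nhole).
  by case: vs es' => [|v vs] [|e es'] // _; apply: Act_trap.
- by move=> es s' F' es1 st; apply: Act_step (R_ctx (L := ESeq vs EHole es') _ st).
- by move=> E x; apply: (@Act_throw F C (ESeq vs E es')).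
- by move=> E vs' x tag; apply: (@Act_suspend F C (ESeq vs E es')).
- by move=> E vs' l ts; apply: (@Act_br F C (ESeq vs E es')).
Qed.

Lemma active_pre F C vs es : active F C es -> active F C (vals vs ++ es).
Proof. by move=> /(active_seq vs [::]); rewrite cats0. Qed.

Lemma step_pre F C vs es s' F' es' :
  step s F es s' F' es' -> active F C (vals vs ++ es).
Proof. by move=> st; apply/active_pre/(Act_step _ st). Qed.

Lemma active_label F C ts es0 es :
  active F (add_label C ts) es -> active F C [:: ILabel (size ts) es0 es].
Proof.
case=> {es}.
- exact: Act_step (R_trap _ _ (E := ELabel _ es0 EHole) isT).
- by move=> es s' F' es1 st; apply: Act_step (R_ctx (L := ELabel _ es0 EHole) _ st).
- by move=> E x; apply: (@Act_throw F C (ELabel _ es0 E)).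
- by move=> E vs x tag; apply: (@Act_suspend F C (ELabel _ es0 E)).
(* Index 0 is this very label, so [R_br] fires; a successor still points outside, and this label now
   counts in the depth of the context. *)
- move=> E vs [|l] ts' fE /= def_l size_vs; last first.
    by rewrite addnS; apply: (@Act_br F C (ELabel _ es0 E)) def_l size_vs.
  case: def_l size_vs => <- size_vs.
  by apply: Act_step; apply: R_br; rewrite // /br_ctx fE addn0 eqxx.
Qed.

Lemma active_frame F F0 C C0 n es :
  c_label C = [::] -> active F C es -> active F0 C0 [:: IFrame n F es].
Proof.
move=> C_nil; case=> {es}.
- exact: Act_step (R_trap _ _ (E := EFrame n F EHole) isT).
- by move=> es s' F' es1 st; apply: Act_step (R_frame_ctx _ _ st).
- by move=> E x; apply: (@Act_throw F0 C0 (EFrame n F E)).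
- by move=> E vs x tag; apply: (@Act_suspend F0 C0 (EFrame n F E)).
- by move=> E vs l ts _; rewrite C_nil; case: l.
Qed.

Lemma active_handler F C C' hs es :
  c_label C' = [::] -> active F C' es -> active F C [:: IHandler hs es].
Proof.
move=> C_nil; case=> {es}.
- exact: Act_step (R_trap _ _ (E := EHandler hs EHole) isT).
- by move=> es s' F' es1 st; apply: Act_step (R_ctx (L := EHandler hs EHole) _ st).
- by move=> E x; apply: (@Act_throw F C (EHandler hs E)).
- move=> E vs x tag uE def_tag size_vs.
  (* A clause for [x] fires [R_suspend]; without one the handler joins the context, which keeps the
     form [E^x]. *)
  case def_l: (find_clause x hs) => [l|].
    have [k fresh_k] := exists_fresh s.
    exact: Act_step (R_suspend _ uE def_tag size_vs def_l fresh_k).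
  by apply: (@Act_suspend F C (EHandler hs E)) def_tag size_vs; rewrite /= def_l.
- by move=> E vs l ts _; rewrite C_nil; case: l.
Qed.

(** * Progress for open sequences *)

(** Quantifying over the operands makes sequencing go through: the values left by a prefix become
    the operands of the next instruction. *)
Definition progresses F C es (ft : functype) : Prop :=
  let: t1 ~> t2 := ft in
  forall vs, vals_typing s vs t1 ->
  (exists2 vs', vals vs ++ es = vals vs' & vals_typing s vs' t2) \/
  active F C (vals vs ++ es).

(** Labels are arbitrary so that the induction enters label bodies, and [F] varies since a frame
    body runs on its own locals. The length bound makes local lookups and updates defined;
    [P = None] rules out the placeholder. *)
Lemma open_progress C P es ft F :
  e_typing s C P es ft -> P = None ->
  c_func C = map func_type (s_func s) -> c_tag C = s_tag s ->
  size (c_local C) <= size F ->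
  progresses F C es ft.
Proof.
move=> typ; elim: typ F => {C P es ft}.
- by move=> C P F _ _ _ _ vs typ_vs; left; exists vs; rewrite ?cats0.
- move=> C P es e t1 t2 t3 _ IH1 _ IH2 F PN Cf Ct Cl vs typ_vs.
  rewrite catA; case: (IH1 F PN Cf Ct Cl vs typ_vs) => [[vs' -> typ_vs']|act].
    exact: IH2 F PN Cf Ct Cl vs' typ_vs'.
  by right; apply: (active_seq [::]).
- move=> C P es ts t1 t2 _ IH F PN Cf Ct Cl vs.
  case/vals_typing_split=> vs1 [vs2 [-> typ1 typ2]]; rewrite vals_cat -catA.
  case: (IH F PN Cf Ct Cl vs2 typ2) => [[vs' -> typ']|act].
    left; exists (vs1 ++ vs'); first by rewrite vals_cat.
    exact: vals_typing_cat.
  by right; apply: active_pre.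
- move=> C P n c F _ _ _ _ vs /vals_typing_size/size0nil->.
  by left; exists [:: VConst c] => //; apply/vals_typing1/T_const.
- move=> C P x t def_x F _ _ _ Cl vs /vals_typing_size/size0nil->; right.
  have lt_x: x < size F by apply: leq_trans Cl; rewrite -onthTE def_x.
  case def_v: (onth F x) (onthTE F x) => [v|]; last by rewrite lt_x.
  by move=> _; apply: Act_step (R_local_get _ def_v).
- move=> C P x t def_x F _ _ _ Cl vs typ_vs; right.
  have lt_x: x < size F by apply: leq_trans Cl; rewrite -onthTE def_x.
  case/(@vals_typing_rcons _ [::]): typ_vs => vs' [v [-> /vals_typing_size/size0nil-> _]].
  exact: Act_step (R_local_set _ _ lt_x).
- move=> C P es t1 t2 _ _ F _ _ _ _ vs /vals_typing_size size_vs; right.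
  exact: Act_step (R_block _ _ _ _ size_vs).
- move=> C P es t1 t2 _ _ F _ _ _ _ vs /vals_typing_size size_vs; right.
  exact: Act_step (R_loop _ _ _ _ size_vs).
- move=> C P l ts t1 t2 def_l F _ _ _ _ vs.
  case/vals_typing_split=> vs1 [vs2 [-> _ /vals_typing_size size2]]; right.
  rewrite vals_cat -catA; apply: active_pre.
  exact: (@Act_br F C EHole vs2 l ts).
- move=> C P l ts def_l F _ _ _ _ vs.
  case/vals_typing_rcons=> vs' [v [-> _ vt]]; right; rewrite vals_cat -catA.
  case: v vt => [[] // c _|r|x [] //|k [? _ [] //]] //.
  have [->|/eqP nz] := eqVneq c (word0 32).
    exact: step_pre (R_br_if_false _ _ _).
  exact: step_pre (R_br_if_true _ _ _ nz).
- move=> C P t1 t2 F _ _ _ _ vs.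
  case/vals_typing_rcons=> vs' [v [-> typ' vt]]; right; rewrite vals_cat -catA.
  case: v vt => [//|r _|x|k [? _ [] //]]; first exact: step_pre (R_null _ _ _ _).
  (* The type recorded for [x] is that of the stored function, so its parameters match the operands
     in number. *)
  case=> ft def_ft [eq_ft]; move: def_ft; rewrite -eq_ft /= onth_map.
  case def_f: (onth (s_func s) x) => [[ft' tl es]|] //= [def_ft'].
  rewrite def_ft' in def_f.
  exact: Act_step (R_call_ref _ _ def_f (vals_typing_size typ')).
- move=> C P t F _ _ _ _ vs /vals_typing_size/size0nil->.
  by left; exists [:: VNull t] => //; apply/vals_typing1/T_ref_null.
- move=> C P x ft def_ft F _ Cf _ _ vs /vals_typing_size/size0nil->.
  rewrite Cf in def_ft.
  by left; exists [:: VFunc x] => //; apply/vals_typing1/T_ref_func.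
- move=> C P x ts t1 t2 _ F _ _ _ _ vs _; right; apply: active_pre.
  exact: (@Act_throw F C EHole).
- move=> C P ft F _ _ _ _ vs.
  case/(@vals_typing_rcons _ [::])=> vs' [v [-> _ vt]]; right; rewrite vals_cat -catA.
  case: v vt => [//|r _|x _|k [? _ [] //]]; first exact: step_pre (R_null _ _ _ _).
  have [k fresh_k] := exists_fresh s.
  exact: step_pre (R_cont_new _ _ _ fresh_k).
- move=> C P hs t1 t2 _ F _ _ _ _ vs.
  case/vals_typing_rcons=> vs' [v [-> typ' vt]]; right; rewrite vals_cat -catA.
  case: v vt => [//|r _|x [] //|k]; first exact: step_pre (R_null _ _ _ _).
  case=> [[E|]] def_k _; last exact: step_pre (R_dead _ _ def_k).
  exact: Act_step (R_resume _ _ _ def_k (vals_typing_size typ')).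
- move=> C P x hs ts t1 t2 _ hs_ok F _ _ Ct _ vs.
  case/vals_typing_rcons=> vs' [v [-> typ' vt]]; right; rewrite vals_cat -catA.
  case: v vt => [//|r _|y [] //|k]; first exact: step_pre (R_null _ _ _ _).
  case=> [[E|]] def_k _; last exact: step_pre (R_dead _ _ def_k).
  rewrite Ct in hs_ok.
  exact: Act_step (R_resume_throw _ _ _ def_k hs_ok (vals_typing_size typ')).
- move=> C P x t1 t2 def_x F _ _ Ct _ vs /vals_typing_size size_vs; right.
  rewrite Ct in def_x.
  exact: (@Act_suspend F C EHole vs x (t1 ~> t2)).
- move=> C P ts t1 t2 F _ _ _ _ vs.
  case/vals_typing_rcons=> vs' [v [-> typ' vt]]; right; rewrite vals_cat -catA.
  case: v vt => [//|r _|y [] //|k]; first exact: step_pre (R_null _ _ _ _).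
  case=> [[E|]] def_k _; last exact: step_pre (R_dead _ _ def_k).
  have [k' fresh_k'] := exists_fresh (set_cont s k Dead).
  apply: Act_step (R_cont_bind _ def_k _ fresh_k').
  by rewrite /= size_cat (vals_typing_size typ').
- by move=> C P t1 t2 F _ _ _ _ vs _; right; apply/active_pre/Act_trap.
- move=> C P k K ft def_K typ_K F _ _ _ _ vs /vals_typing_size/size0nil->.
  by left; exists [:: VCont k] => //; apply/vals_typing1/(T_ref_cont _ _ def_K).
- move=> C P n es0 es t1 t2 <- _ _ _ IH F PN Cf Ct Cl vs.
  move=> /vals_typing_size/size0nil->; right.
  case: (IH F PN Cf Ct Cl [::] (T_vals_nil s)) => [[vs' /= -> _]|act].
    exact: Act_step (R_label _ _ _ _ _).
  exact: active_label.
- move=> C P n F1 es tl ts <- typ_F1 _ IH F PN _ _ _ vs.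
  move=> /vals_typing_size/size0nil->; right.
  have le_tl: size tl <= size F1 by rewrite (vals_typing_size typ_F1).
  case: (IH F1 PN erefl erefl le_tl [::] (T_vals_nil s)) => [[vs' /= -> typ']|act].
    (* [R_frame] asks for exactly the announced number of values; the typing of the values left by
       the body supplies it. *)
    exact: Act_step (R_frame _ _ _ (vals_typing_size typ')).
  exact: active_frame act.
- move=> C P hs es ts _ _ IH F PN Cf Ct _ vs.
  move=> /vals_typing_size/size0nil->; right.
  (* [strip] leaves no locals, so the length bound is trivial. *)
  case: (IH F PN Cf Ct isT [::] (T_vals_nil s)) => [[vs' /= -> _]|act].
    exact: Act_step (R_handler _ _ _ _).
  exact: active_handler act.
- by [].
Qed.

End Typing.

Theorem theorem3p2 (s : store) (F : frame) (es : seq instr)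
    (ts : seq valtype) :
  config_typing s F es ts ->
  is_result es \/
  exists (s' : store) (F' : frame) (es' : seq instr), step s F es s' F' es'.
Proof.
case=> _ [tl [typ_F typ_es]].
have le_tl: size tl <= size F by rewrite (vals_typing_size typ_F).
have := open_progress typ_es erefl erefl erefl le_tl [::] (T_vals_nil s).
case=> [[vs /= -> _]|/= []]; first by left; apply: Res_vals.
- by left; apply: Res_trap.
- by move=> es1 s' F' es' st; right; exists s', F', es'.
- by left; apply: Res_throw.
- move=> E vs x tag uE _ _; left.
  (* A result has a bare suspension in its hole, so the operands move into the context. *)
  rewrite -[vals vs ++ _]/(fill (ESeq vs EHole [::]) [:: ISuspend x]) -fill_ecomp.
  by apply: Res_suspend; rewrite unhandled_ecomp uE.
(* A configuration is typed without labels, so no branch can be pending. *)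
- by move=> E vs [].
Qed.
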